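(* Let $\rho_{-\frac12}$ be the Borel probability measure on $\mathbb{R}^2$ $$\rho_{-\frac12}=\frac12\left(\mathcal{L}_{[-\frac12,\frac12]}\times\delta_0+\delta_0\times\mathcal{L}_{[-\frac12,\frac12]}\right).$$ Then the Plus space $L^2(\rho_{-\frac12})$ admits no exponential orthogonal basis; that is, there is no countable set $\Lambda\subset\mathbb{R}^2$ such that $\{e^{-2\pi i\lambda\cdot x}:\lambda\in\Lambda\}$ is an orthogonal basis of $L^2(\rho_{-\frac12})$.
   Context: $\mathcal{L}_{[a,b]}$ denotes Lebesgue measure on $\mathbb{R}$ restricted to $[a,b]$, and $\delta_0$ the Dirac measure at $0\in\mathbb{R}$. *)

(* Defs.v *)
From HB Require Import structures.
From mathcomp Require Import all_boot all_order all_algebra.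
From mathcomp Require Import all_classical all_reals all_analysis.
From mathcomp Require Import lra complex.

Set Implicit Arguments.
Unset Strict Implicit.
Unset Printing Implicit Defensive.
Import Order.TTheory GRing.Theory Num.Theory.
Import numFieldNormedType.Exports.

Local Open Scope classical_set_scope.
Local Open Scope ring_scope.
Local Open Scope complex_scope.

Section complex_L2.
Context d (T : measurableType d) (R : realType).
Variable mu : {measure set T -> \bar R}.
Implicit Types f g : T -> R[i].

Definition cintegral f : R[i] :=
  Complex (\int[mu]_x complex.Re (f x)) (\int[mu]_x complex.Im (f x)).

Definition L2norm f : \bar R := 'N[mu]_2%:E[EFin \o (@Normc.normc R \o f)]%E.

(* Functions, not classes modulo [mu]-a.e. equality. *)
Definition L2 : set (T -> R[i]) := [set f |
  [/\ measurable_fun setT (fun x => complex.Re (f x)),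
      measurable_fun setT (fun x => complex.Im (f x)) &
      (L2norm f < +oo)%E]].

Definition L2dot f g : R[i] := cintegral (fun x => f x * (g x)^*%C).

Section basis.
Context (I : eqType).
Variables (A : set I) (e : I -> T -> R[i]).

Definition family_span : set (T -> R[i]) := [set g |
  exists s c, [set` s] `<=` A /\ g = (fun x => \sum_(i <- s) c i * e i x)].

(* The family [e] indexed by [A] is an orthogonal basis of the Hilbert space
   L2(mu): nonzero, pairwise orthogonal vectors with a dense linear span. *)
Definition orthogonal_basis : Prop :=
  [/\ forall i, A i -> L2 (e i) /\ (0 < L2norm (e i))%E,
      forall i j, A i -> A j -> i <> j -> L2dot (e i) (e j) = 0 &
      forall f, L2 f -> forall eps : R, 0 < eps ->
        exists2 g, family_span g & (L2norm (fun x => f x - g x)%R < eps%:E)%E].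

End basis.

End complex_L2.

Section plus_space.
Context (R : realType).

Local Notation mR := (measurableTypeR R).

Definition lebesgue_on (a b : R) : set mR -> \bar R :=
  mrestr (@lebesgue_measure R) (measurable_itv `[a, b]).

HB.instance Definition _ a b := Measure.on (lebesgue_on a b).

Let lebesgue_onT a b :
  lebesgue_on a b setT = if a < b then (b - a)%:E else 0%E.
Proof.
by rewrite /lebesgue_on /mrestr setTI lebesgue_measure_itv /= lte_fin -EFinB.
Qed.

Let lebesgue_on_fin a b : fin_num_fun (lebesgue_on a b).
Proof.
apply: lty_fin_num_fun; rewrite [X in (X < _)%E]lebesgue_onT.
by case: ifP => _; rewrite ltry.
Qed.

HB.instance Definition _ a b :=
  @Measure_isFinite.Build _ _ _ (lebesgue_on a b) (@lebesgue_on_fin a b).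

Local Notation half := (2^-1 : R).

Definition plus_measure : set (mR * mR) -> \bar R :=
  mscale (half%:nng) (measure_add
    (lebesgue_on (- half) half \x \d_(0%R : mR))%E
    (\d_(0%R : mR) \x lebesgue_on (- half) half)%E).

HB.instance Definition _ := Measure.on plus_measure.

Let plus_measure_setT : plus_measure setT = 1%E.
Proof.
rewrite /plus_measure /mscale [X in (_ * X)%E]measure_addE -setXTT.
rewrite [X in (_ * (X + _))%E]product_measure1E//.
rewrite [X in (_ * (_ + X))%E]product_measure1E//.
rewrite [X in (_ * (_ * X + _))%E]diracT [X in (_ * (_ + X * _))%E]diracT.
rewrite mule1 mul1e [X in (_ * (X + _))%E]lebesgue_onT.
rewrite [X in (_ * (_ + X))%E]lebesgue_onT.
have h0 : - half < half by lra.
rewrite h0 -EFinD -EFinM opprK /=; congr (_%:E); lra.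
Qed.

HB.instance Definition _ :=
  @Measure_isProbability.Build _ _ _ plus_measure plus_measure_setT.

(* [expi t] is e^(it). *)
Definition expi (t : R) : R[i] := Complex (cos t) (sin t).

Definition exponential (l x : R * R) : R[i] :=
  expi (- (2 * pi * (l.1 * x.1 + l.2 * x.2))).

End plus_space.

(* Main.v *)
(* Write sinc y = sin y / y.  Two exponentials with frequencies (a, b) and
   (a', b') are orthogonal iff sinc (pi (a - a')) = - sinc (pi (b - b')).  As
   sinc > - 1/3 everywhere and sinc y >= 1 - y^2/6, this forces
   |pi (a - a')| >= 2: the first coordinates of an orthogonal family are
   well separated, so there are too few of them for completeness.  Indeed, let
   f be the exponential of frequency (a0, b0) in the family, cut to the
   horizontal arm.  Then |f|^2 = 1/2, whereas its squared coefficients are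
   sinc(pi (a0 - a))^2 / 4, whose sum is at most (1 + 7/8) / 4 by separation;
   hence f stays at squared distance at least 1/32 from the span. *)
Require Import Defs.
From mathcomp Require Import all_boot all_order all_algebra.
From mathcomp Require Import all_classical all_reals all_analysis.
From mathcomp Require Import measurable_realfun.
From mathcomp Require Import ring lra complex.

Set Implicit Arguments.
Unset Strict Implicit.
Unset Printing Implicit Defensive.
Import Order.TTheory GRing.Theory Num.Theory.
Import numFieldNormedType.Exports.

Local Open Scope classical_set_scope.
Local Open Scope ring_scope.

(** * Bounds on sine and [sinc], and sums of inverse squares over separated points *)

Section sinc.
Context {R : realType}.
Implicit Types x y z : R.

(** By the mean value theorem, [f x] is [x] times a value of [df] strictly between 0 and [x]. This
    turns an inequality between derivatives into one between functions. *)
Lemma ge0_derive_ge0 (f df : R -> R) x :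
  (forall y, is_derive y 1 f (df y)) -> (forall y, 0 < y < x -> 0 <= df y) ->
  f 0 = 0 -> 0 <= x -> 0 <= f x.
Proof.
move=> fdf df0 f0; rewrite le_eqVlt => /predU1P[<-|x0]; first by rewrite f0.
have cf : {within `[0, x], continuous f}.
  apply: continuous_subspaceT => y; apply: differentiable_continuous.
  by apply/derivable1_diffP; apply: ex_derive.
have [c + fx] := MVT x0 (fun y _ => fdf y) cf.
rewrite in_itv /= -[f x]subr0 -[in f x - _]f0 fx subr0 => /df0 dfc.
by rewrite mulr_ge0// ltW.
Qed.

Lemma sin_le x : 0 <= x -> sin x <= x.
Proof.
move=> x0; rewrite -subr_ge0.
apply: (@ge0_derive_ge0 (fun x => x - sin x) (fun x => 1 - cos x)) => //.
by rewrite sin0 subr0.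
Qed.

Lemma norm_sin_le x : `|sin x| <= `|x|.
Proof.
wlog x0 : x / 0 <= x => [h|].
  by have [/h//|/ltW x0] := leP 0 x; rewrite -normrN -sinN -[leRHS]normrN h ?oppr_ge0.
rewrite (ger0_norm x0) ler_norml sin_le// andbT.
(* Past 1 the bound [-1 <= sin x] suffices; up to 1, which is below [pi], the sine is
   nonnegative. *)
have [x1|x1] := leP x 1; last by rewrite (le_trans _ (sin_geN1 x))// lerN2 ltW.
rewrite (@le_trans _ _ 0)// ?oppr_le0// sin_ge0_pi// x0 (le_trans x1)//.
by rewrite (le_trans _ (pi_ge2 R))// ler1n.
Qed.

(** Half-angle formula: cos x = 1 - 2 sin^2 (x/2), and |sin (x/2)| <= |x/2|. *)
Lemma cos_ge x : 1 - x ^+ 2 / 2 <= cos x.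
Proof.
have xE : x = (x / 2) *+ 2 by rewrite -mulr_natr divfK ?pnatr_eq0.
rewrite [in cos _]xE cos_mulr2n.
have := norm_sin_le (x / 2); rewrite -ler_sqr ?nnegrE// !real_normK ?num_real//.
have := cos2Dsin2 (x / 2); lra.
Qed.

Lemma sin_ge x : 0 <= x -> x - x ^+ 3 / 6 <= sin x.
Proof.
move=> x0; rewrite -subr_ge0.
pose df (y : R) := cos y - (1 - y ^+ 2 / 2).
apply: (@ge0_derive_ge0 (fun x => sin x - (x - x ^+ 3 / 6)) df) => //.
- move=> y; apply: is_derive_eq; rewrite /df /= /GRing.scale /=; by field.
- by move=> y _; rewrite subr_ge0 cos_ge.
- by rewrite sin0 expr0n /= mul0r !subrr.
Qed.

(** Apply sin x <= x at pi/6, where the sine is 1/2. *)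
Lemma pi_ge3 : 3 <= pi :> R.
Proof.
have pi0 := pi_gt0 R.
have s0 : 0 < sin (pi / 6) :> R by apply: sin_gt0_pi; apply/andP; split; lra.
have s12 : sin (pi / 6) = 2^-1 :> R.
  (* Put s = sin (pi/6). The double angle pi/3 is also pi/2 - pi/6, so s = cos (pi/3) = 1 - 2 s^2,
     whose only positive root is 1/2. *)
  have := cos_mulr2n (pi / 6 : R).
  rewrite (_ : pi / 6 *+ 2 = pi / 2 - pi / 6); last by rewrite -mulr_natr; field.
  rewrite cosB cos_pihalf sin_pihalf mul0r add0r mul1r.
  have := cos2Dsin2 (pi / 6 : R); nra.
have := @sin_le (pi / 6); rewrite s12; lra.
Qed.

(** The value at 0 is the continuous extension, so that integrals of cosines are given by [sinc] at
    frequency 0 too. *)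
Definition sinc x : R := if x == 0 then 1 else sin x / x.

Lemma sinc0 : sinc 0 = 1.
Proof. by rewrite /sinc eqxx. Qed.

Lemma sincN x : sinc (- x) = sinc x.
Proof. by rewrite /sinc oppr_eq0 sinN invrN mulrNN. Qed.

Lemma norm_sinc_le x : `|x| * `|sinc x| <= 1.
Proof.
rewrite /sinc; case: eqVneq => [->|x0]; first by rewrite normr0 mul0r.
by rewrite normrM normfV mulrC divfK ?normr_eq0// sin_max.
Qed.

(** On [0, pi] the function is nonnegative; beyond [pi] its modulus is at most 1/x < 1/pi <= 1/3. *)
Lemma sinc_gt x : - 3^-1 < sinc x.
Proof.
wlog x0 : x / 0 <= x => [h|].
  by have [/h//|/ltW x0] := leP 0 x; rewrite -sincN h ?oppr_ge0.
have [xpi|pix] := leP x pi.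
  apply: (@lt_le_trans _ _ 0); first by lra.
  rewrite /sinc; case: eqVneq => // _; apply: divr_ge0 => //.
  by rewrite sin_ge0_pi// x0.
have := norm_sinc_le x; rewrite ger0_norm// => xs.
have := ler_norm (- sinc x); rewrite normrN.
have := normr_ge0 (sinc x).
have := pi_ge3; nra.
Qed.

Lemma sinc_ge x : 1 - x ^+ 2 / 6 <= sinc x.
Proof.
wlog x0 : x / 0 <= x => [h|].
  by have [/h//|/ltW x0] := leP 0 x; rewrite -sincN -sqrrN h ?oppr_ge0.
rewrite /sinc; case: eqVneq => [->|xn0]; first by rewrite expr0n/= mul0r subr0.
have xgt0 : 0 < x by rewrite lt_def xn0.
rewrite ler_pdivlMr//; have := sin_ge x0; lra.
Qed.

(** If |x| < 2, then sinc x >= 1 - x^2/6 > 1/3, which sinc y > -1/3 cannot cancel. *)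
Lemma sinc_add0 x y : sinc x + sinc y = 0 -> 2 <= `|x|.
Proof.
move=> xy0; rewrite leNgt; apply/negP => x2.
have := sinc_ge x; have := sinc_gt y.
have : x ^+ 2 < 4 by rewrite -(real_normK (num_real x)); have := normr_ge0 x; nra.
lra.
Qed.

(** Telescoping with 1/k^2 <= 1/(k-1) - 1/k from k = 3 on. The first two terms are kept exact: 1 +
    1/4 = 7/4 - 1/2, which improves on the cruder bound 2. *)
Lemma sum_inv_sqr n : \sum_(1 <= k < n.+3) (k%:R ^+ 2)^-1 <= 7 / 4 - n.+2%:R^-1 :> R.
Proof.
elim: n => [|n IH]; first by rewrite big_nat_recr// big_nat_recr// big_geq//=; lra.
rewrite big_nat_recr//=.
have n0 : 0 < n.+2%:R :> R by [].
have n1 : n.+3%:R = n.+2%:R + 1 :> R by rewrite -natr1.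
have : (n.+3%:R ^+ 2)^-1 <= n.+2%:R^-1 - n.+3%:R^-1 :> R.
  rewrite n1; have : 0 < n.+2%:R + 1 :> R by lra.
  move: (n.+2%:R : R) n0 => t t0 t1.
  rewrite -subr_ge0.
  rewrite (_ : _ - _ = ((t + 1) ^+ 2 * t)^-1).
    by rewrite invr_ge0 mulr_ge0// ?exprn_ge0// ltW.
  by field; rewrite !gt_eqF.
by move=> h; rewrite (le_trans (lerD IH h))// addrA subrK.
Qed.

(** Distinct positive integers bounded by their maximum give a subsum of a full initial sum. *)
Lemma sum_inv_sqr_uniq (s : seq nat) : uniq s -> all (fun k => 0 < k)%N s ->
  \sum_(k <- s) (k%:R ^+ 2)^-1 <= 7 / 4 :> R.
Proof.
move=> us s0; pose n := \max_(k <- s) k.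
apply: (@le_trans _ _ (\sum_(1 <= k < n.+3) (k%:R ^+ 2)^-1)); last first.
  by rewrite (le_trans (sum_inv_sqr n))// gerBl.
rewrite [leRHS](bigID (mem s)) /= -[in leRHS]big_filter.
rewrite [X in _ <= X + _](perm_big s) ?lerDl ?sumr_ge0//; last first.
apply: uniq_perm => //; first by rewrite filter_uniq ?iota_uniq.
move=> k; rewrite mem_filter mem_index_iota; case: (boolP (k \in s)) => //= ks.
rewrite (allP s0)//= ltnS (leq_trans _ (leqW (leqnSn _)))//.
by rewrite /n (big_rem k)//= leq_maxl.
Qed.

(* Truncating [y / 2] sends a 2-separated family to distinct positive integers. *)
Lemma sum_inv_sqr_pos (I : eqType) (s : seq I) (f : I -> R) :
  uniq s -> {in s, forall i, 2 <= f i} ->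
  {in s &, forall i j, i != j -> 2 <= `|f i - f j|} ->
  \sum_(i <- s) (f i ^+ 2)^-1 <= 7 / 16.
Proof.
move=> us f2 fs; pose k i := Num.truncn (f i / 2).
have kP i : i \in s -> (k i)%:R <= f i / 2 < (k i)%:R + 1.
  by move=> /f2 fi; rewrite natr1 truncn_itv// divr_ge0//; lra.
have k0 i : i \in s -> (0 < k i)%N.
  move=> iS; have := kP _ iS; have := f2 _ iS.
  by case: (k i) => //; lra.
(* Since 2 k <= f, each term 1/f^2 is at most (1/4) (1/k^2). *)
have -> : 7 / 16 = 4^-1 * (7 / 4) :> R by field.
apply: (@le_trans _ _ (4^-1 * \sum_(i <- map k s) (i%:R ^+ 2)^-1)); last first.
  rewrite ler_pM2l ?invr_gt0// sum_inv_sqr_uniq//.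
    rewrite map_inj_in_uniq// => i j iS jS kij; apply/eqP; apply: contraT => ij.
    have := fs _ _ iS jS ij; rewrite leNgt ltr_norml.
    have := kP _ iS; have := kP _ jS; rewrite kij => jj ii.
    by rewrite (_ : _ && _); [|apply/andP; split; lra].
  by apply/allP => _ /mapP[i iS ->]; exact: k0.
rewrite big_map mulr_sumr big_seq [leRHS]big_seq; apply: ler_sum => i iS.
have := kP _ iS => /andP[ki _].
have ki0 : 0 < (k i)%:R :> R by rewrite ltr0n k0.
have fi0 : 0 < f i by have := f2 _ iS; lra.
rewrite -invfM lef_pV2 ?posrE ?mulr_gt0 ?exprn_gt0//; nra.
Qed.

(** Split by sign and reflect the negative points: each half is a positive 2-separated family and
    contributes at most 7/16. *)
Lemma sum_inv_sqr_sep (I : eqType) (s : seq I) (f : I -> R) :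
  uniq s -> {in s, forall i, 2 <= `|f i|} ->
  {in s &, forall i j, i != j -> 2 <= `|f i - f j|} ->
  \sum_(i <- s) (f i ^+ 2)^-1 <= 7 / 8.
Proof.
move=> us f2 fs; rewrite (bigID (fun i => 0 <= f i)) /=.
have -> : 7 / 8 = 7 / 16 + 7 / 16 :> R by field.
rewrite -big_filter -[X in _ + X]big_filter; apply: lerD.
  apply: sum_inv_sqr_pos; first by rewrite filter_uniq.
  - by move=> i; rewrite mem_filter => /andP[i0 /f2]; rewrite ger0_norm.
  - by move=> i j; rewrite !mem_filter => /andP[_ iS] /andP[_ jS]; exact: fs.
under eq_bigr do rewrite -sqrrN.
apply: sum_inv_sqr_pos; first by rewrite filter_uniq.
- move=> i; rewrite mem_filter -ltNge => /andP[i0 /f2].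
  by rewrite ltr0_norm.
- move=> i j; rewrite !mem_filter => /andP[_ iS] /andP[_ jS] ij.
  by rewrite -opprD normrN fs.
Qed.

End sinc.

(** * Integration against the plus measure, reduced to its two arms *)

Section plus_integral.
Context {R : realType}.
Local Notation mR := (measurableTypeR R).
Local Notation leb := (@lebesgue_measure R).
Local Notation half := (2^-1 : R).
Local Notation J := [set` `[(- half)%R, half]].

Section ge0.
Local Open Scope ereal_scope.

Lemma ge0_integral_lebesgue_on (a b : R) (f : mR -> \bar R) :
  measurable_fun [set: mR] f -> (forall x, 0 <= f x) ->
  \int[lebesgue_on a b]_x f x = \int[leb]_(x in `[a, b]) f x.
Proof.
move=> mf f0.
have mI : measurable (`[a, b]%classic : set mR) by exact: measurable_itv.
transitivity (\int[lebesgue_on a b]_(x in `[a, b]) f x).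
  rewrite -(setCK `[a, b]%classic) -setTD.
  apply: ge0_negligible_integral => //; first exact: measurableC.
  by rewrite /= /lebesgue_on /mrestr setICl measure0.
apply: eq_measure_integral => A mA AI; rewrite /=/lebesgue_on /mrestr.
by congr lebesgue_measure; apply/setIidl.
Qed.

(** Tonelli, in a different order for each of the two products, so that the Dirac factor is
    integrated first and evaluates the other coordinate at 0. *)
Lemma ge0_integral_plus_measure (f : mR * mR -> \bar R) :
  measurable_fun [set: mR * mR] f -> (forall x, 0 <= f x) ->
  \int[@plus_measure R]_x f x = half%:E *
    (\int[leb]_(x in J) f (x, 0%R) + \int[leb]_(y in J) f (0%R, y)).
Proof.
move=> mf f0.
rewrite [LHS]ge0_integral_mscale// ge0_integral_measure_add//.
rewrite fubini_tonelli1// fubini_tonelli2// /fubini_F /fubini_G.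
have mf1 : measurable_fun [set: mR] (fun x : mR => f (x, 0%R)).
  exact: measurableT_comp.
have mf2 : measurable_fun [set: mR] (fun y : mR => f (0%R, y)).
  exact: measurableT_comp.
congr (_ * (_ + _)).
- rewrite -(ge0_integral_lebesgue_on _ _ mf1)//; apply: eq_integral => x _.
  rewrite (@integral_dirac _ mR 0%R _ setT measurableT (fun y => f (x, y)))
    ?diracT ?mul1e//.
  exact: measurableT_comp.
- rewrite -(ge0_integral_lebesgue_on _ _ mf2)//; apply: eq_integral => y _.
  rewrite (@integral_dirac _ mR 0%R _ setT measurableT (fun x => f (x, y)))
    ?diracT ?mul1e//.
  exact: measurableT_comp.
Qed.

End ge0.

(** Adding the constant [M] makes [f] nonnegative, so the previous formula applies; [M] then cancels
    on both sides. *)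
Lemma Rintegral_plus_measure (f : mR * mR -> R) (M : R) :
  measurable_fun setT f -> (forall x, `|f x| <= M) ->
  \int[@plus_measure R]_x f x =
    2^-1 * (\int[leb]_(x in J) f (x, 0) + \int[leb]_(y in J) f (0, y)).
Proof.
move=> mf fM.
have M0 : 0 <= M by rewrite (le_trans _ (fM (0, 0))).
have bnd d (T : measurableType d) (mu : {measure set T -> \bar R}) (D : set T)
    (g : T -> R) :
    measurable D -> (mu D < +oo)%E -> measurable_fun D g ->
    (forall x, `|g x| <= M) -> mu.-integrable D (EFin \o g).
  move=> mD muD mg gM; apply: measurable_bounded_integrable => //.
  exists M; split; first exact: num_real.
  by move=> N MN x _ /=; rewrite (le_trans (gM x))// ltW.
have PT : @plus_measure R setT = 1%E := probability_setT _.
have JT : leb J = 1%E.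
  rewrite lebesgue_measure_itv /= lte_fin ifT; last by lra.
  by rewrite -EFinB; congr (_%:E); lra.
have mJ : measurable (J : set mR) by exact: measurable_itv.
have mf1 : measurable_fun [set: mR] (fun x : mR => f (x, 0)).
  exact: measurableT_comp.
have mf2 : measurable_fun [set: mR] (fun y : mR => f (0, y)).
  exact: measurableT_comp.
(* The plus measure and each arm have total mass 1, so the shift raises every integral by exactly
   [M]. *)
have shift d (T : measurableType d) (mu : {measure set T -> \bar R}) (D : set T)
    (g : T -> R) :
    measurable D -> mu D = 1%E -> measurable_fun D g ->
    (forall x, `|g x| <= M) ->
    (\int[mu]_(x in D) (g x + M)%:E = (\int[mu]_(x in D) g x + M)%:E)%E.
  move=> mD muD mg gM.
  have ig : mu.-integrable D (EFin \o g) by apply: bnd; rewrite // muD ltry.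
  have iM : mu.-integrable D (EFin \o cst M).
    by apply: bnd; rewrite ?muD ?ltry// => x /=; rewrite ger0_norm.
  rewrite -[RHS](_ : (\int[mu]_(x in D) (g x + M))%:E = _)%E.
    rewrite /Rintegral fineK//; apply: integrable_fin_num => //.
    have := integrableD mD ig iM; apply: eq_integrable => // x _ /=.
  by rewrite RintegralD// Rintegral_cst// muD mulr1.
have := @ge0_integral_plus_measure (fun x => (f x + M)%:E).
rewrite shift// !shift//; [|exact: measurable_funTS..].
move=> H; have := H _ _.
rewrite -EFinD -EFinM => {}H.
suff : (\int[@plus_measure R]_x f x + M) =
   2^-1 * (\int[leb]_(x in J) f (x, 0) + M + (\int[leb]_(y in J) f (0, y) + M)) by lra.
apply: EFin_inj; apply: H.
- by apply/measurable_EFinP; apply: measurable_funD.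
- by move=> x; rewrite lee_fin -lerBlDr sub0r lerNl (le_trans _ (fM x))//
  -normrN ler_norm.
Qed.

End plus_integral.

(** * Integrals of cosines and sines over the symmetric unit interval *)

Section trigonometric_integrals.
Context {R : realType}.
Local Notation leb := (@lebesgue_measure R).
Local Notation half := (2^-1 : R).
Local Notation J := [set` `[- half, half]].

Lemma Rintegral_FTC (f F : R -> R) (a b : R) : a < b -> continuous f ->
  (forall x : R, is_derive x 1 F (f x)) ->
  \int[leb]_(x in `[a, b]) f x = F b - F a.
Proof.
move=> ab cf dF.
have cF : continuous F.
  move=> x; apply: differentiable_continuous.
  by apply/derivable1_diffP; apply: ex_derive.
rewrite /Rintegral (@continuous_FTC2 _ _ F)//.
- exact: continuous_subspaceT.
- split; first by move=> x _; apply: ex_derive.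
  + by apply: cvg_at_right_filter; exact: cF.
  + by apply: cvg_at_left_filter; exact: cF.
- by move=> x _; rewrite derive1E; apply: derive_val.
Qed.

Lemma continuous_mulC_comp (f : R -> R) (c : R) :
  continuous f -> continuous (fun x => f (c * x)).
Proof.
by move=> cf x; apply: continuous_comp; [exact: mulrl_continuous|exact: cf].
Qed.

Lemma Rintegral_cos (c : R) : \int[leb]_(x in J) cos (c * x) = sinc (c / 2).
Proof.
have half2 : - half < half by lra.
(* Frequency 0 is treated apart, since the antiderivative sin (c x) / c needs a nonzero [c]. *)
rewrite /sinc mulf_eq0 invr_eq0 pnatr_eq0 orbF; case: eqVneq => [->|c0].
  under eq_Rintegral do rewrite mul0r cos0.
  by rewrite (@Rintegral_FTC (cst 1) id)//; [lra|exact: cst_continuous].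
have dF (x : R) : is_derive x 1 (fun x => sin (c * x) / c) (cos (c * x)).
  by apply: is_derive_eq; rewrite /GRing.scale /=; field.
rewrite (Rintegral_FTC half2 _ dF).
  by rewrite mulrN sinN; field.
by apply: continuous_mulC_comp; exact: continuous_cos.
Qed.

Lemma Rintegral_sin (c : R) : \int[leb]_(x in J) sin (c * x) = 0.
Proof.
have half2 : - half < half by lra.
have [->|c0] := eqVneq c 0.
  under eq_Rintegral do rewrite mul0r sin0.
  by rewrite (@Rintegral_FTC (cst 0) (cst 0)) ?subrr//; exact: cst_continuous.
have dF (x : R) : is_derive x 1 (fun x => - cos (c * x) / c) (sin (c * x)).
  by apply: is_derive_eq; rewrite /GRing.scale /=; field.
rewrite (Rintegral_FTC half2 _ dF); first by rewrite mulrN cosN subrr.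
by apply: continuous_mulC_comp; exact: continuous_sin.
Qed.

End trigonometric_integrals.

(** * Inner products of bounded functions, and a Bessel inequality *)

Section bounded_L2.
Context d (T : measurableType d) (R : realType).
Variable mu : {finite_measure set T -> \bar R}.
Implicit Types (f g h : T -> R[i]) (c : R[i]).
Local Notation Re := complex.Re.
Local Notation Im := complex.Im.

Lemma ReD (x y : R[i]) : Re (x + y) = Re x + Re y.
Proof. by case: x; case: y. Qed.
Lemma ImD (x y : R[i]) : Im (x + y) = Im x + Im y.
Proof. by case: x; case: y. Qed.
Lemma ReM (x y : R[i]) : Re (x * y) = Re x * Re y - Im x * Im y.
Proof. by case: x; case: y. Qed.
Lemma ImM (x y : R[i]) : Im (x * y) = Re x * Im y + Im x * Re y.
Proof. by case: x; case: y. Qed.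
Lemma ReJ (x : R[i]) : Re (x^*)%C = Re x.
Proof. by case: x. Qed.
Lemma ImJ (x : R[i]) : Im (x^*)%C = - Im x.
Proof. by case: x. Qed.
Definition ReImE := (ReD, ImD, ReM, ImM, ReJ, ImJ).

Lemma eq_ReIm (x y : R[i]) : Re x = Re y -> Im x = Im y -> x = y.
Proof. by case: x => a b; case: y => a' b' /= -> ->. Qed.

(** Over a finite measure this class lies in L^1 and is closed under sums and products. It contains
    the real and imaginary parts of everything in the argument (exponentials, their cuts, finite
    combinations), so integrability is automatic. *)
Definition bounded_rfun (f : T -> R) :=
  measurable_fun setT f /\ exists M : R, forall x, `|f x| <= M.

Definition bounded_cfun f := 
  bounded_rfun (fun x => Re (f x)) /\ bounded_rfun (fun x => Im (f x)).

Lemma bounded_rfunD (f g : T -> R) :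
  bounded_rfun f -> bounded_rfun g -> bounded_rfun (fun x => f x + g x).
Proof.
move=> [mf [M fM]] [mg [N gN]]; split; first exact: measurable_funD.
by exists (M + N) => x; rewrite (le_trans (ler_normD _ _))// lerD.
Qed.

Lemma bounded_rfunM (f g : T -> R) :
  bounded_rfun f -> bounded_rfun g -> bounded_rfun (fun x => f x * g x).
Proof.
move=> [mf [M fM]] [mg [N gN]]; split; first exact: measurable_funM.
by exists (M * N) => x; rewrite normrM ler_pM.
Qed.

Lemma bounded_rfun_cst (r : R) : bounded_rfun (fun=> r).
Proof. by split => //; exists `|r|. Qed.

Lemma bounded_rfunN (f : T -> R) :
  bounded_rfun f -> bounded_rfun (fun x => - f x).
Proof.
move=> [mf [M fM]]; split; first exact: measurableT_comp.
by exists M => x; rewrite normrN.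
Qed.

Lemma bounded_rfun_integrable (f : T -> R) :
  bounded_rfun f -> mu.-integrable setT (EFin \o f).
Proof.
move=> [mf [M fM]]; apply: measurable_bounded_integrable => //.
  by rewrite -ge0_fin_numE// fin_num_measure.
exists M; split; first exact: num_real.
by move=> N MN x _ /=; rewrite (le_trans (fM x))// ltW.
Qed.

Lemma bounded_cfunD f g :
  bounded_cfun f -> bounded_cfun g -> bounded_cfun (fun x => f x + g x).
Proof.
move=> [f1 f2] [g1 g2]; split.
  rewrite (_ : (fun _ => _) = fun x => Re (f x) + Re (g x)); first exact: bounded_rfunD.
  by apply/funext => x /=; rewrite ReImE.
rewrite (_ : (fun _ => _) = fun x => Im (f x) + Im (g x)); first exact: bounded_rfunD.
by apply/funext => x /=; rewrite ReImE.
Qed.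

Lemma bounded_cfunM f g :
  bounded_cfun f -> bounded_cfun g -> bounded_cfun (fun x => f x * g x).
Proof.
move=> [f1 f2] [g1 g2]; split.
  rewrite (_ : (fun _ => _) = fun x => Re (f x) * Re (g x) + - (Im (f x) * Im (g x))).
    by apply: bounded_rfunD; [|apply: bounded_rfunN]; exact: bounded_rfunM.
  by apply/funext => x /=; rewrite ReImE.
rewrite (_ : (fun _ => _) = fun x => Re (f x) * Im (g x) + Im (f x) * Re (g x)).
  by apply: bounded_rfunD; exact: bounded_rfunM.
by apply/funext => x /=; rewrite ReImE.
Qed.

Lemma bounded_cfun_cst c : bounded_cfun (fun=> c).
Proof. by split; exact: bounded_rfun_cst. Qed.

Lemma bounded_cfunJ f : bounded_cfun f -> bounded_cfun (fun x => (f x)^*%C).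
Proof.
move=> [f1 f2]; split.
  rewrite (_ : (fun _ => _) = fun x => Re (f x))//.
  by apply/funext => x /=; rewrite ReImE.
rewrite (_ : (fun _ => _) = fun x => - Im (f x)); first exact: bounded_rfunN.
by apply/funext => x /=; rewrite ReImE.
Qed.

Lemma bounded_cfunB f g :
  bounded_cfun f -> bounded_cfun g -> bounded_cfun (fun x => f x - g x).
Proof.
move=> bf bg; apply: bounded_cfunD => //.
rewrite (_ : (fun _ => _) = fun x => -1 * g x).
  exact: (bounded_cfunM (bounded_cfun_cst _)).
by apply/funext => x; rewrite mulN1r.
Qed.

Lemma bounded_cfun_sum (I : eqType) (s : seq I) (e : I -> T -> R[i]) :
  {in s, forall i, bounded_cfun (e i)} ->
  bounded_cfun (fun x => \sum_(i <- s) e i x).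
Proof.
elim: s => [_|i s IH bs].
  by under [X in bounded_cfun X]eq_fun do rewrite big_nil; exact: bounded_cfun_cst.
under [X in bounded_cfun X]eq_fun do rewrite big_cons.
apply: bounded_cfunD; first by apply: bs; rewrite mem_head.
by apply: IH => j js; apply: bs; rewrite in_cons js orbT.
Qed.

Lemma cintegralD f g : bounded_cfun f -> bounded_cfun g ->
  cintegral mu (fun x => f x + g x) = cintegral mu f + cintegral mu g.
Proof.
move=> [f1 f2] [g1 g2]; apply: eq_ReIm; rewrite ReImE /=.
  under eq_Rintegral do rewrite ReImE.
  by rewrite RintegralD//; exact: bounded_rfun_integrable.
under eq_Rintegral do rewrite ReImE.
by rewrite RintegralD//; exact: bounded_rfun_integrable.
Qed.

Lemma cintegralZ c f : bounded_cfun f ->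
  cintegral mu (fun x => c * f x) = c * cintegral mu f.
Proof.
move=> [/bounded_rfun_integrable f1 /bounded_rfun_integrable f2].
have iZ (r : R) (g : T -> R) : mu.-integrable setT (EFin \o g) ->
    mu.-integrable setT (EFin \o (fun x => r * g x)).
  by move=> ig; apply: (integrableZl _ r ig).
apply: eq_ReIm; rewrite ReImE /=.
  under eq_Rintegral do rewrite ReImE.
  by rewrite RintegralB ?RintegralZl//; exact: iZ.
under eq_Rintegral do rewrite ReImE.
by rewrite RintegralD ?RintegralZl//; exact: iZ.
Qed.

Lemma L2dotDl f g h : bounded_cfun f -> bounded_cfun g -> bounded_cfun h ->
  L2dot mu (fun x => f x + g x) h = L2dot mu f h + L2dot mu g h.
Proof.
move=> bf bg bh; have bhJ := bounded_cfunJ bh.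
rewrite /L2dot -cintegralD; [|exact: bounded_cfunM..].
by congr cintegral; apply/funext => x; rewrite mulrDl.
Qed.

Lemma L2dotZl c f g : bounded_cfun f -> bounded_cfun g ->
  L2dot mu (fun x => c * f x) g = c * L2dot mu f g.
Proof.
move=> bf bg; have bgJ := bounded_cfunJ bg.
rewrite /L2dot -cintegralZ; last exact: bounded_cfunM.
by congr cintegral; apply/funext => x; rewrite mulrA.
Qed.

Lemma L2dotC f g : bounded_cfun f -> bounded_cfun g ->
  L2dot mu g f = (L2dot mu f g)^*%C.
Proof.
move=> bf bg; have bfJ := bounded_cfunJ bf; have bgJ := bounded_cfunJ bg.
apply: eq_ReIm; rewrite ReImE /=.
  by apply: eq_Rintegral => x _; rewrite !ReImE; ring.
rewrite -mulN1r -RintegralZl//.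
  by apply: eq_Rintegral => x _; rewrite !ReImE; ring.
by apply: bounded_rfun_integrable; case: (bounded_cfunM bf bgJ).
Qed.

Lemma L2dotBZl f g h c : bounded_cfun f -> bounded_cfun g -> bounded_cfun h ->
  L2dot mu (fun x => f x - c * g x) h = L2dot mu f h - c * L2dot mu g h.
Proof.
move=> bf bg bh; have bc := bounded_cfunM (bounded_cfun_cst (- c)) bg.
rewrite -mulNr -L2dotZl// -L2dotDl//.
by congr L2dot; apply/funext => x; rewrite mulNr.
Qed.

(** This carries the density condition, stated with the extended-real norm, over to inner
    products. *)
Lemma L2norm_bounded f : bounded_cfun f ->
  L2norm mu f = (Num.sqrt (Re (L2dot mu f f)))%:E.
Proof.
move=> bf; have [bff _] := bounded_cfunM bf (bounded_cfunJ bf).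
have ffE x : Re (f x * (f x)^*%C) = Re (f x) ^+ 2 + Im (f x) ^+ 2.
  by rewrite !ReImE mulrN opprK.
have dot0 : 0 <= Re (L2dot mu f f).
  by apply: Rintegral_ge0 => x _; rewrite ffE addr_ge0 ?sqr_ge0.
rewrite /L2norm unlock -powR12_sqrt// -poweR_EFin; congr (_ `^ _)%E.
rewrite /= /Rintegral fineK; last first.
  exact: integrable_fin_num (bounded_rfun_integrable bff).
apply: eq_integral => x _; rewrite ffE /=.
case: (f x) => a b /=; rewrite ger0_norm ?sqrtr_ge0//.
by rewrite powR_mulrn ?sqrtr_ge0// sqr_sqrtr ?addr_ge0 ?sqr_ge0.
Qed.

(* Subtracting [c i * e i] from [f] leaves its inner products with the other
   vectors unchanged, so the terms can be peeled off one at a time. *)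
Lemma bessel_dist (I : eqType) (s : seq I) (c : I -> R[i]) (e : I -> T -> R[i]) f g :
  uniq s -> bounded_cfun f -> {in s, forall i, bounded_cfun (e i)} ->
  {in s, forall i, L2dot mu (e i) (e i) = 1} ->
  {in s &, forall i j, i != j -> L2dot mu (e i) (e j) = 0} ->
  g =1 (fun x => f x - \sum_(i <- s) c i * e i x) ->
  Re (L2dot mu f f) -
    \sum_(i <- s) (Re (L2dot mu f (e i)) ^+ 2 + Im (L2dot mu f (e i)) ^+ 2)
  <= Re (L2dot mu g g).
Proof.
elim: s f g => [|i s IH] f g.
  move=> _ _ _ _ _ gE; rewrite big_nil subr0.
  by have -> : g = f by apply/funext => x; rewrite gE big_nil subr0.
rewrite cons_uniq => /andP[iNs us] bf be e1 e0 gE.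
have bi : bounded_cfun (e i) by apply: be; rewrite mem_head.
have sub j : j \in s -> j \in i :: s by rewrite in_cons orbC => ->.
have bci := bounded_cfunM (bounded_cfun_cst (c i)) bi.
pose f' x := f x - c i * e i x.
have bf' : bounded_cfun f' by apply: bounded_cfunB.
apply: le_trans (IH f' g us bf' _ _ _ _); last 4 first.
- by move=> j /sub; exact: be.
- by move=> j /sub; exact: e1.
- by move=> j k /sub jS /sub kS; exact: e0.
- by move=> x; rewrite gE big_cons opprD addrA.
have dotj j : j \in s -> L2dot mu f' (e j) = L2dot mu f (e j).
  move=> js; rewrite L2dotBZl//; last by apply/be/sub.
  rewrite (e0 i j) ?mulr0 ?subr0 ?mem_head ?sub//.
  by apply: contraNneq iNs => ->.
rewrite big_cons opprD addrA.
rewrite [in leRHS]big_seq; under [in leRHS]eq_bigr do rewrite dotj//.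
rewrite -big_seq lerB//.
rewrite L2dotBZl// (L2dotC bf' bf) (L2dotC bf' bi) !L2dotBZl//.
rewrite e1 ?mem_head// (L2dotC bf bi) (L2dotC bf bf).
move: (L2dot mu f f) (L2dot mu f (e i)) (c i) => [a a'] [x y] [u v].
rewrite !ReImE /=.
(* With [c i] = u + iv and coefficient <f, e_i> = x + iy, completing the square gives |f'|^2 = |f|^2
   - (x^2 + y^2) + (u - x)^2 + (v - y)^2. *)
have := sqr_ge0 (u - x); have := sqr_ge0 (v - y); nra.
Qed.

End bounded_L2.

(** * Exponentials and their horizontal cuts in the Plus space *)

Section exponentials.
Context {R : realType}.
Implicit Types l m x : R * R.
Local Notation mR := (measurableTypeR R).
Local Notation Re := complex.Re.
Local Notation Im := complex.Im.
Local Notation P := (@plus_measure R).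

Lemma exponentialMJ l m x : exponential l x * (exponential m x)^*%C =
  expi (- (2 * pi * (l.1 - m.1) * x.1 + 2 * pi * (l.2 - m.2) * x.2)).
Proof.
rewrite (_ : - _ = - (2 * pi * (l.1 * x.1 + l.2 * x.2)) -
  - (2 * pi * (m.1 * x.1 + m.2 * x.2))); last by ring.
by apply: eq_ReIm; rewrite !ReImE /= ?cosB ?sinB; ring.
Qed.

Lemma measurable_phase (a b : R) :
  measurable_fun setT (fun x : mR * mR => - (a * x.1 + b * x.2)).
Proof.
apply: measurableT_comp => //.
by apply: measurable_funD; apply: measurable_funM.
Qed.

Lemma bounded_cos_phase (a b : R) :
  bounded_rfun (fun x : mR * mR => cos (- (a * x.1 + b * x.2))).
Proof.
split; last by exists 1 => x; exact: cos_max.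
apply: measurableT_comp (measurable_phase a b).
by apply: continuous_measurable_fun; exact: continuous_cos.
Qed.

Lemma bounded_sin_phase (a b : R) :
  bounded_rfun (fun x : mR * mR => sin (- (a * x.1 + b * x.2))).
Proof.
split; last by exists 1 => x; exact: sin_max.
apply: measurableT_comp (measurable_phase a b).
by apply: continuous_measurable_fun; exact: continuous_sin.
Qed.

Lemma bounded_exponential l :
  @bounded_cfun _ (mR * mR)%type R (exponential l).
Proof.
have phaseE x : 2 * pi * (l.1 * x.1 + l.2 * x.2) =
    2 * pi * l.1 * x.1 + 2 * pi * l.2 * x.2 by ring.
split.
  under [X in bounded_rfun X]eq_fun do rewrite /exponential phaseE.
  exact: bounded_cos_phase.
under [X in bounded_rfun X]eq_fun do rewrite /exponential phaseE.
exact: bounded_sin_phase.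
Qed.

(** The product is the exponential of the frequency difference. On each arm only one coordinate
    survives: its cosine integrates to a [sinc], its sine to 0 by symmetry. *)
Lemma L2dot_exponential l m : L2dot P (exponential l) (exponential m) =
  Complex ((sinc (pi * (l.1 - m.1)) + sinc (pi * (l.2 - m.2))) / 2) 0.
Proof.
rewrite /L2dot (_ : (fun x => _) = fun x => expi
    (- (2 * pi * (l.1 - m.1) * x.1 + 2 * pi * (l.2 - m.2) * x.2))); last first.
  by apply/funext => x; exact: exponentialMJ.
apply: eq_ReIm => /=.
  rewrite (Rintegral_plus_measure (bounded_cos_phase _ _).1 (fun=> cos_max _)) /=.
  under eq_Rintegral do rewrite mulr0 addr0 cosN.
  under [X in _ * (_ + X)]eq_Rintegral do rewrite mulr0 add0r cosN.
  by rewrite !Rintegral_cos mulrC; congr ((sinc _ + sinc _) / 2); field.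
rewrite (Rintegral_plus_measure (bounded_sin_phase _ _).1 (fun=> sin_max _)) /=.
under eq_Rintegral do rewrite mulr0 addr0 -mulNr.
under [X in _ * (_ + X)]eq_Rintegral do rewrite mulr0 add0r -mulNr.
by rewrite !Rintegral_sin addr0 mulr0.
Qed.

(** The test function that the span fails to approximate. On the vertical arm it is nonzero only at
    the origin, a null set there. *)
Definition horizontal l x : R[i] := if x.2 == 0 then exponential l x else 0.

Lemma bounded_horizontal_if (f : mR * mR -> R) : bounded_rfun f ->
  bounded_rfun (fun x : mR * mR => if x.2 == 0 then f x else 0).
Proof.
move=> [mf [M fM]]; split; last first.
  by exists M => x; case: ifP => // _; rewrite normr0 (le_trans _ (fM x)).
apply: measurable_fun_if => //; last exact: measurable_funTS.
by apply: measurable_fun_eqr => //; exact: measurable_snd.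
Qed.

Lemma bounded_horizontal l :
  @bounded_cfun _ (mR * mR)%type R (horizontal l).
Proof.
have [b1 b2] := bounded_exponential l; split.
  rewrite (_ : (fun _ => _) = fun x : mR * mR =>
    if x.2 == 0 then Re (exponential l x) else 0); first exact: bounded_horizontal_if.
  by apply/funext => x; rewrite /horizontal; case: ifP.
rewrite (_ : (fun _ => _) = fun x : mR * mR =>
  if x.2 == 0 then Im (exponential l x) else 0); first exact: bounded_horizontal_if.
by apply/funext => x; rewrite /horizontal; case: ifP.
Qed.

(** The vertical arm meets the horizontal axis only at the origin, so its contribution is an
    integral over a single point. *)
Lemma Rintegral_plus_measure_horizontal (f : mR * mR -> R) :
  bounded_rfun f ->
  \int[P]_x (if x.2 == 0 then f x else 0) =
  2^-1 * \int[lebesgue_measure]_(x in [set` `[- 2^-1, 2^-1]]) f (x, 0).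
Proof.
move=> bf; have [mf [M fM]] := bounded_horizontal_if bf.
rewrite (Rintegral_plus_measure mf fM) /= eqxx.
rewrite [X in _ + X](_ : _ = 0) ?addr0//.
transitivity (\int[@lebesgue_measure R]_(y in [set` `[- 2^-1, 2^-1]])
    ((fun y => f (0, y)) \_ [set 0]) y).
  apply: eq_Rintegral.
  move=> y _; rewrite patchE; case: eqVneq => [->|y0].
    by rewrite mem_set.
  by rewrite memNset// => /eqP; rewrite (negPf y0).
rewrite -Rintegral_mkcondr (_ : _ `&` _ = [set 0]) ?Rintegral_set1//.
by rewrite setIC; apply/setIidl => _ ->; rewrite /= in_itv /=; apply/andP; split; lra.
Qed.

Lemma L2dot_horizontal_exponential l m :
  L2dot P (horizontal l) (exponential m) =
  Complex (sinc (pi * (l.1 - m.1)) / 2) 0.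
Proof.
rewrite /L2dot (_ : (fun x => _) = fun x => if x.2 == 0 then expi
    (- (2 * pi * (l.1 - m.1) * x.1 + 2 * pi * (l.2 - m.2) * x.2)) else 0); last first.
  apply/funext => x; rewrite -exponentialMJ /horizontal.
  by case: ifP; rewrite ?mul0r.
apply: eq_ReIm => /=; under eq_Rintegral do
    rewrite (fun_if (@complex.Re R), fun_if (@complex.Im R)) /=.
  rewrite (Rintegral_plus_measure_horizontal (bounded_cos_phase _ _)) /=.
  under eq_Rintegral do rewrite mulr0 addr0 cosN.
  by rewrite !Rintegral_cos mulrC; congr (sinc _ / 2); field.
rewrite (Rintegral_plus_measure_horizontal (bounded_sin_phase _ _)) /=.
under eq_Rintegral do rewrite mulr0 addr0 -mulNr.
by rewrite !Rintegral_sin mulr0.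
Qed.

Lemma L2dot_horizontal l :
  L2dot P (horizontal l) (horizontal l) = Complex 2^-1 0.
Proof.
transitivity (L2dot P (horizontal l) (exponential l)).
  congr cintegral; apply/funext => x; rewrite /horizontal.
  by case: ifP; rewrite ?mul0r.
by rewrite L2dot_horizontal_exponential subrr mulr0 sinc0 mul1r.
Qed.

Lemma orthogonal_exponentials_separated l m :
  L2dot P (exponential l) (exponential m) = 0 -> 2 <= `|pi * (l.1 - m.1)|.
Proof.
rewrite L2dot_exponential => -[/eqP].
rewrite mulf_eq0 invr_eq0 pnatr_eq0 orbF => /eqP; exact: sinc_add0.
Qed.

(** The term at [l] itself is 1. The others are at most 1/y^2, where the points y = pi (l.1 - i.1)
    have modulus at least 2 and are 2-separated. *)
Lemma sum_sinc_le (s : seq (R * R)) l : uniq s -> l \in s ->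
  {in s &, forall i j, i != j -> 2 <= `|pi * (i.1 - j.1)|} ->
  \sum_(i <- s) (sinc (pi * (l.1 - i.1))) ^+ 2 <= 1 + 7 / 8.
Proof.
move=> us ls sep; rewrite (big_rem l)//= subrr mulr0 sinc0 expr1n lerD2l.
have remP i : i \in rem l s -> l != i /\ i \in s.
  by rewrite (rem_filter _ us) mem_filter /= eq_sym => /andP.
apply: (@le_trans _ _ (\sum_(i <- rem l s) ((pi * (l.1 - i.1)) ^+ 2)^-1)).
  rewrite big_seq [leRHS]big_seq; apply: ler_sum => i /remP[li si].
  have y2 := sep _ _ ls si li.
  have y0 : 0 < (pi * (l.1 - i.1)) ^+ 2.
    by rewrite exprn_even_gt0//= -normr_gt0; lra.
  rewrite -[leRHS]mul1r ler_pdivlMr// -exprMn -[1](expr1n _ 2).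
  rewrite -[leLHS]real_normK ?num_real// ler_sqr ?nnegrE// normrM mulrC.
  exact: norm_sinc_le.
apply: sum_inv_sqr_sep; first exact: rem_uniq.
- by move=> i /remP[li si]; exact: sep.
- move=> i j /remP[_ si] /remP[_ sj] ij.
  by rewrite -mulrBr opprB addrC subrKA sep// eq_sym.
Qed.

End exponentials.

(** * The horizontal cut of an exponential stays away from the span *)

Theorem proposition4p3 (R : realType) :
  ~ exists Lambda : set (R * R), countable Lambda /\
      orthogonal_basis (@plus_measure R) Lambda (@exponential R).
Proof.
move=> [L [_ [_ Lorth Ldense]]].
(* The default (0, 0) is taken only when [L] is empty; that case is settled at the end. *)
pose l0 := xget (0, 0) L; pose f := horizontal l0.
have bf := bounded_horizontal l0.
have L2f : L2 (@plus_measure R) f.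
  by case: (bf) => -[m1 _] [m2 _]; split => //; rewrite L2norm_bounded// ltry.
(* The squared distance to the span is at least 1/2 - (15/8)/4 = 1/32, above (1/8)^2 = 1/64. *)
have e0 : (0 : R) < 8^-1 by [].
have [_ [s [c [sL ->]]]] := Ldense f L2f _ e0.
apply/negP; rewrite -leNgt.
have {sL} sL i : i \in undup s -> L i by rewrite mem_undup => /sL.
have us := undup_uniq s.
(* The list [s] may repeat frequencies, whereas the Bessel inequality wants distinct ones:
   repetitions are merged into the coefficients. *)
pose c' i := c i *+ count_mem i s.
have sumE x : \sum_(i <- s) c i * exponential i x =
    \sum_(i <- undup s) c' i * exponential i x.
  rewrite -big_undup_iterop_count/=; apply: eq_bigr => i _.
  by rewrite /c' mulrnAl.
under eq_fun do rewrite sumE.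
move: (undup s) c' us sL {sumE} => {}s {}c us sL.
have bexp i : i \in s -> bounded_cfun (@exponential R i).
  by move=> _; exact: bounded_exponential.
rewrite L2norm_bounded; last first.
  apply: bounded_cfunB => //; apply: bounded_cfun_sum => i /bexp bi.
  by apply: bounded_cfunM => //; exact: bounded_cfun_cst.
have orth i j : L i -> L j -> i != j ->
    L2dot (@plus_measure R) (exponential i) (exponential j) = 0.
  by move=> Li Lj /eqP; exact: Lorth.
have sep i j : L i -> L j -> i != j -> 2 <= `|pi * (i.1 - j.1)|.
  by move=> Li Lj /orth => /(_ Li Lj)/orthogonal_exponentials_separated.
have H := @bessel_dist _ _ R (@plus_measure R) _ s c (@exponential R) f _ us bf bexp
  _ _ (fun=> erefl).
rewrite lee_fin -[8^-1]ger0_norm// -sqrtr_sqr ler_wsqrtr//.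
apply: le_trans (H _ _); last 2 first.
- by move=> i _; rewrite L2dot_exponential !subrr !mulr0 sinc0; congr Complex; field.
- by move=> i j /sL Li /sL Lj; exact: orth.
rewrite L2dot_horizontal.
under eq_bigr do rewrite L2dot_horizontal_exponential /= expr0n addr0 exprMn.
rewrite -mulr_suml /=.
suff : \sum_(i <- s) sinc (pi * (l0.1 - i.1)) ^+ 2 <= 1 + 7 / 8 by lra.
(* If [l0] is not in [L], then [L] is empty, hence so is [s], and the sum is 0. *)
have [Ll0|Ll0] := pselect (L l0); last first.
  rewrite big_seq big_pred0 => [|i]; first by lra.
  by apply/negbTE/negP => /sL Li; apply: Ll0; apply: xgetPex; exists i.
have [l0s|l0s] := boolP (l0 \in s).
  by apply: sum_sinc_le => // i j /sL Li /sL Lj; exact: sep.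
(* When [l0] is missing from [s], adjoining it only increases the sum and keeps the frequencies in
   [L], hence separated. *)
have us0 : uniq (l0 :: s) by rewrite /= l0s.
have := @sum_sinc_le _ (l0 :: s) l0 us0 (mem_head _ _).
rewrite big_cons => H0; apply: le_trans (H0 _); first by rewrite lerDr sqr_ge0.
have sL0 i : i \in l0 :: s -> L i by rewrite inE => /predU1P[->//|/sL].
by move=> i j /sL0 Li /sL0 Lj; exact: sep.
Qed.
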